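(* Consider a sequence of experiments indexed by the sample size $n$ in which, for each $n$, treatment is assigned by a Bernoulli randomization design, and suppose the regularity conditions (Assumption R in the context) hold. If $d_{\mathrm{avg}}=o(n)$ (restricted interference), then the Horvitz–Thompson estimator $\hat\tau_{HT}$ and the Hájek estimator $\hat\tau_{HA}$ are consistent for $\tau_{EATE}$ (i.e. $\hat\tau_{HT}-\tau_{EATE}\to 0$ and $\hat\tau_{HA}-\tau_{EATE}\to 0$ in probability as $n\to\infty$), and $$\hat\tau_{HT}-\tau_{EATE}=O_p\big(n^{-1/2}d_{\mathrm{avg}}^{1/2}\big),\qquad \hat\tau_{HA}-\tau_{EATE}=O_p\big(n^{-1/2}d_{\mathrm{avg}}^{1/2}\big).$$
   Context: Setting. For each sample size $n$ there are units $U=\{1,\dots,n\}$ and arbitrary potential outcome functions $y_i:\{0,1\}^n\to\mathbb R$, $i\in U$. For $\mathbf z\in\{0,1\}^n$, $\mathbf z_{-i}\in\{0,1\}^{n-1}$ is $\mathbf z$ with its $i$th entry deleted, and $y_i(\mathbf z)$ is also written $y_i(z_i;\mathbf z_{-i})$. An experimental design is the probability distribution of a random vector $\mathbf Z=(Z_1,\dots,Z_n)\in\{0,1\}^n$; it is the only source of randomness. Write $Y_i=y_i(\mathbf Z)$ and $p_i=\Pr(Z_i=1)$. All objects (units, potential outcomes, design) depend on $n$, with no relation assumed between different $n$; asymptotics are as $n\to\infty$. Assumption R (regularity conditions). There are constants $k<\infty$, $q\ge 2$, $s\ge 1$ such that for all $n$ and all $i\in U$: $k^{-1}\le \Pr(Z_i=1)\le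 1-k^{-1}$; $E[|Y_i|^q]\le k^q$; and $E[|y_i(z;\mathbf Z_{-i})|^s]\le k^s$ for $z\in\{0,1\}$. Bernoulli randomization design: $\Pr(\mathbf Z=\mathbf z)=\prod_{i=1}^n p_i^{z_i}(1-p_i)^{1-z_i}$ (the $p_i$ may differ and depend on $n$, subject to Assumption R). Interference. $I_{ij}=1$ if $i=j$ or if $y_j(\mathbf z)\ne y_j(\mathbf z')$ for some $\mathbf z,\mathbf z'\in\{0,1\}^n$ with $\mathbf z_{-i}=\mathbf z'_{-i}$; otherwise $I_{ij}=0$. $d_{ij}=1$ if $I_{\ell i}I_{\ell j}=1$ for some $\ell\in U$, else $d_{ij}=0$; $d_{\mathrm{avg}}=n^{-1}\sum_{i=1}^n\sum_{j=1}^n d_{ij}$. Estimand: $\tau_{EATE}=n^{-1}\sum_{i=1}^n E[y_i(1;\mathbf Z_{-i})-y_i(0;\mathbf Z_{-i})]$, expectation over the (unconditional) design. Estimators: $\hat\tau_{HT}=\frac1n\sum_i \frac{Z_iY_i}{p_i}-\frac1n\sum_i\frac{(1-Z_i)Y_i}{1-p_i}$ and $\hat\tau_{HA}=\Big(\sum_i\frac{Z_iY_i}{p_i}\Big/\sum_i\frac{Z_i}{p_i}\Big)-\Big(\sum_i\frac{(1-Z_i)Y_i}{1-p_i}\Big/\sum_i\frac{1-Z_i}{1-p_i}\Big)$, where a ratio with zero denominator is assigned the value $0$. $X_n=O_p(a_n)$ means that for every $\varepsilon>0$ there is $M<\infty$ with $\Pr(|X_n|>M a_n)\le\varepsilon$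 for all sufficiently large $n$. *)

(* Defs.v *)
From HB Require Import structures.
From mathcomp Require Import all_boot all_order all_algebra.
From mathcomp Require Import all_classical all_reals all_analysis.

Set Implicit Arguments.
Unset Strict Implicit.
Unset Printing Implicit Defensive.

Import Order.TTheory GRing.Theory Num.Theory.
Import numFieldNormedType.Exports.

Local Open Scope classical_set_scope.
Local Open Scope ring_scope.

Definition assignment (n : nat) := {ffun 'I_n -> bool}.

Definition outcomes (R : realType) (n : nat) := 'I_n -> assignment n -> R.

Definition delete (n : nat) (i : 'I_n) (z : assignment n) : assignment n.-1 :=
  [ffun j => z (lift i j)].

(* [y i (insert i b w)] is y_i(b; w). *)
Definition insert (n : nat) (i : 'I_n) (b : bool) (w : assignment n.-1) :
    assignment n :=
  [ffun j => if unlift i j is Some j' then w j' else b].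

(* A design is the law of Z on {0,1}^n, given by its mass function; since it is
   the only source of randomness, random variables are functions of the
   assignment. *)
Record design (R : realType) (n : nat) := Design {
  mass :> assignment n -> R;
  mass_ge0 : forall z, 0 <= mass z;
  mass_sum1 : \sum_z mass z = 1
}.

Section Experiment.
Context {R : realType} {n : nat}.
Implicit Types (D : design R n) (y : outcomes R n) (z : assignment n).

Definition Pr D (A : pred (assignment n)) : R := \sum_(z | A z) D z.

Definition Ex D (X : assignment n -> R) : R := \sum_z D z * X z.

Definition prob_treated D (i : 'I_n) : R := Pr D (fun z => z i).

Definition bernoulli_design D : Prop :=
  forall z, D z = \prod_i (prob_treated D i ^+ z i *
                           (1 - prob_treated D i) ^+ (1 - z i)%N).

Definition interferes y (i j : 'I_n) : bool :=
  (i == j) || [exists z : assignment n, exists z' : assignment n,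
                 (delete i z == delete i z') && (y j z != y j z')].

Definition dependent y (i j : 'I_n) : bool :=
  [exists l : 'I_n, interferes y l i && interferes y l j].

Definition d_avg y : R := n%:R^-1 * \sum_i \sum_j (dependent y i j)%:R.

Definition tau_EATE D y : R :=
  n%:R^-1 * \sum_i Ex D (fun z => y i (insert i true (delete i z)) -
                                  y i (insert i false (delete i z))).

Definition tau_HT D y z : R :=
  n%:R^-1 * (\sum_i (z i)%:R * y i z / prob_treated D i) -
  n%:R^-1 * (\sum_i (1 - (z i)%:R) * y i z / (1 - prob_treated D i)).

(* Since x / 0 = 0 in a field, a ratio with zero denominator is 0 here. *)
Definition tau_HA D y z : R :=
  (\sum_i (z i)%:R * y i z / prob_treated D i) /
    (\sum_i (z i)%:R / prob_treated D i) -
  (\sum_i (1 - (z i)%:R) * y i z / (1 - prob_treated D i)) /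
    (\sum_i (1 - (z i)%:R) / (1 - prob_treated D i)).

End Experiment.

Section Sequence.
Context {R : realType}.
Variable D : forall n, design R n.

(* 0 < k is implicit in k^-1 <= Pr(Z_i = 1) <= 1 - k^-1; it must be explicit
   because inverses and powers are total operations. *)
Definition regularity (y : forall n, outcomes R n) : Prop :=
  exists k q s : R, [/\ 0 < k, 2 <= q, 1 <= s &
    forall (n : nat) (i : 'I_n),
      [/\ k^-1 <= prob_treated (D n) i <= 1 - k^-1,
          Ex (D n) (fun z => `|y n i z| `^ q) <= k `^ q &
          forall b : bool,
            Ex (D n) (fun z => `|y n i (insert i b (delete i z))| `^ s)
              <= k `^ s]].

Definition cvg_in_prob0 (X : forall n, assignment n -> R) : Prop :=
  forall e : R, 0 < e -> Pr (D n) (fun z => e < `|X n z|) @[n --> \oo] --> (0 : R).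

Definition bigO_in_prob (X : forall n, assignment n -> R) (a : nat -> R) : Prop :=
  forall e : R, 0 < e -> exists M : R,
    \forall n \near \oo, Pr (D n) (fun z => M * a n < `|X n z|) <= e.

End Sequence.

(* Main.v *)
(** The inverse-probability weighted mean of the outcomes in one arm is
unbiased, because Z_i is independent of Z_{-i}. The i-th summand depends only on
the coordinates that interfere with i, so summands i and j with d_ij = 0 are
independent and the mean square error is O(d_avg / n). Chebyshev's inequality
gives the rate for each arm, hence for the Horvitz-Thompson estimator. For the
Hajek estimator write A/B - m = (A - mB)/B: the numerator is the weighted mean of
the centered outcomes and B tends to 1 in probability. *)
Require Import Defs.
From HB Require Import structures.
From mathcomp Require Import all_boot all_order all_algebra.
From mathcomp Require Import all_classical all_reals all_analysis.
From mathcomp Require Import ring lra.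

Set Implicit Arguments.
Unset Strict Implicit.
Unset Printing Implicit Defensive.

Import Order.TTheory GRing.Theory Num.Theory.
Import numFieldNormedType.Exports.

Local Open Scope classical_set_scope.
Local Open Scope ring_scope.

(** * Expectation, probability and Chebyshev's inequality for a finite design *)

Section Expectation.
Context {R : realType} {n : nat}.
Implicit Types (D : design R n) (X Y : assignment n -> R).

Lemma eq_Ex D X Y : X =1 Y -> Ex D X = Ex D Y.
Proof. by move=> XY; apply: eq_bigr => z _; rewrite XY. Qed.

Lemma Ex_cst D (c : R) : Ex D (fun=> c) = c.
Proof. by rewrite /Ex -mulr_suml mass_sum1 mul1r. Qed.

Lemma ExD D X Y : Ex D (fun z => X z + Y z) = Ex D X + Ex D Y.
Proof. by rewrite /Ex -big_split; apply: eq_bigr => z _; rewrite mulrDr. Qed.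

Lemma ExZ D (c : R) X : Ex D (fun z => c * X z) = c * Ex D X.
Proof. by rewrite /Ex mulr_sumr; apply: eq_bigr => z _; rewrite mulrCA. Qed.

Lemma ExB D X Y : Ex D (fun z => X z - Y z) = Ex D X - Ex D Y.
Proof.
rewrite -mulN1r -ExZ -ExD; apply: eq_Ex => z.
by rewrite mulN1r.
Qed.

Lemma Ex_sum D (I : finType) (X : I -> assignment n -> R) :
  Ex D (fun z => \sum_i X i z) = \sum_i Ex D (X i).
Proof.
rewrite /Ex exchange_big; apply: eq_bigr => z _.
by rewrite mulr_sumr.
Qed.

Lemma ler_Ex D X Y : (forall z, X z <= Y z) -> Ex D X <= Ex D Y.
Proof. by move=> XY; apply: ler_sum => z _; rewrite ler_wpM2l ?mass_ge0. Qed.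

Lemma ler_norm_Ex D X : `|Ex D X| <= Ex D (fun z => `|X z|).
Proof.
apply: le_trans (ler_norm_sum _ _ _) _; apply: ler_sum => z _.
by rewrite normrM (ger0_norm (mass_ge0 _ _)).
Qed.

(** The variance is E[X^2] - m^2 with m = E[X], and m^2 is nonnegative. *)
Lemma Ex_sqr_centered D X :
  Ex D (fun z => (X z - Ex D X) ^+ 2) <= Ex D (fun z => X z ^+ 2).
Proof.
set m := Ex D X.
rewrite (@eq_Ex _ _ (fun z => X z ^+ 2 - ((2 * m) * X z - m ^+ 2))); last first.
  by move=> z; ring.
rewrite !ExB ExZ Ex_cst -/m.
by have := sqr_ge0 m; nra.
Qed.

Lemma PrE D (A : pred (assignment n)) : Pr D A = Ex D (fun z => (A z)%:R).
Proof.
rewrite /Pr /Ex big_mkcond; apply: eq_bigr => z _.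
by case: (A z); rewrite ?mulr1 ?mulr0.
Qed.

Lemma Pr_ge0 D (A : pred (assignment n)) : 0 <= Pr D A.
Proof. by apply: sumr_ge0 => z _; exact: mass_ge0. Qed.

Lemma ler_Pr D (A B : pred (assignment n)) :
  (forall z, A z -> B z) -> Pr D A <= Pr D B.
Proof.
move=> AB; rewrite !PrE; apply: ler_Ex => z.
by have := AB z; case: (A z) => [->|_]; rewrite ?ler0n.
Qed.

Lemma Pr_union_le D (A B C : pred (assignment n)) :
  (forall z, A z -> B z || C z) -> Pr D A <= Pr D B + Pr D C.
Proof.
move=> ABC; rewrite !PrE -ExD; apply: ler_Ex => z.
have := ABC z; case: (A z); last by rewrite addr_ge0 ?ler0n.
by move=> /(_ isT); case: (B z); case: (C z) => //= _; rewrite ?addr0 ?add0r ?lerDl.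
Qed.

Lemma chebyshev_Pr D X (t : R) : 0 < t ->
  Pr D (fun z => t < `|X z|) <= Ex D (fun z => X z ^+ 2) / t ^+ 2.
Proof.
move=> t0; rewrite PrE mulrC -ExZ; apply: ler_Ex => z.
have [tX|_] := ltP t; last by rewrite mulr_ge0 ?sqr_ge0 // invr_ge0 sqr_ge0.
rewrite ler_pdivlMl ?exprn_gt0// mulr1 -[leRHS]real_normK ?num_real//.
by rewrite lerXn2r ?nnegrE// ltW.
Qed.

End Expectation.

(** * Independence of functions of disjoint coordinates, and sums with few dependent pairs *)

Section Independence.
Context {R : realType} {n : nat}.
Implicit Types (D : design R n) (A B : pred 'I_n) (z : assignment n).

(** Plays the role of measurability with respect to the coordinates in [A]. *)
Definition depends_on A (X : assignment n -> R) :=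
  forall z z', (forall i, A i -> z i = z' i) -> X z = X z'.

Definition splice A z z' : assignment n :=
  [ffun i => if A i then z i else z' i].

(* E[F] E[G] is a sum over pairs (z, z'); exchanging the two assignments
   outside A preserves the product weight and moves F and G to one assignment. *)
Lemma Ex_indep D A B (F G : assignment n -> R) : bernoulli_design D ->
  (forall i, A i -> ~~ B i) -> depends_on A F -> depends_on B G ->
  Ex D (fun z => F z * G z) = Ex D F * Ex D G.
Proof.
move=> Db AB FA GB.
pose sw (p : assignment n * assignment n) := (splice A p.1 p.2, splice A p.2 p.1).
have swK : involutive sw.
  move=> [z z']; rewrite /sw /=; congr pair; apply/ffunP => i; rewrite !ffunE.
    by case: (A i).
  by case: (A i).
have massM z z' : D z * D z' = D (splice A z z') * D (splice A z' z).
  rewrite ![D _]Db -!big_split; apply: eq_bigr => i _ /=; rewrite !ffunE.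
  by case: (A i) => //; rewrite mulrC.
transitivity (\sum_(p : assignment n * assignment n) D p.1 * D p.2 * (F p.1 * G p.1)).
  rewrite -(pair_bigA _ (fun z z' => D z * D z' * (F z * G z))) /=.
  apply: eq_bigr => z _; under eq_bigr do rewrite mulrAC.
  by rewrite -mulr_sumr mass_sum1 mulr1.
rewrite (reindex_inj (inv_inj swK)) /= {1}/Ex mulr_suml.
rewrite -(pair_bigA _ (fun z z' => D (splice A z z') * D (splice A z' z) *
   (F (splice A z z') * G (splice A z z')))) /=.
apply: eq_bigr => z _; rewrite mulr_sumr; apply: eq_bigr => z' _.
rewrite -massM (FA _ z) ?(GB (splice A z z') z'); first by ring.
- by move=> i Bi; rewrite ffunE; case: ifP => // /AB; rewrite Bi.
- by move=> i Ai; rewrite ffunE Ai.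
Qed.

(** Interference is defined by changing one coordinate, whereas here two assignments may differ in
    many. One passes from [z] to [z'] by changing the differing coordinates one at a time, by
    induction on a bound on their number. *)
Lemma depends_on_interferes (y : outcomes R n) (j : 'I_n) :
  depends_on (fun i => interferes y i j) (y j).
Proof.
move=> z z'; move: {2}#|_| (leqnn #|[set i | z i != z' i]|%SET) => m.
elim: m z => [|m IH] z.
  rewrite leqn0 cards_eq0 => /eqP/setP zz' _; congr (y j _); apply/ffunP => i.
  by have := zz' i; rewrite !inE => /negbFE/eqP.
move=> zm zz'; have [i zi|zz] := pickP (fun i => z i != z' i); last first.
  by congr (y j _); apply/ffunP => i; apply/eqP/negbFE/zz.
pose z1 : assignment n := [ffun l => if l == i then z' i else z l].
(* If resetting coordinate [i] changed [y j], then [i] would interfere with [j], so [z] and [z']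
   would already agree at [i]. *)
have -> : y j z = y j z1.
  apply/eqP; apply: contraNT zi => yz; apply/eqP/zz'.
  rewrite /interferes; apply/orP; right; apply/existsP; exists z; apply/existsP; exists z1.
  rewrite yz andbT; apply/eqP/ffunP => l; rewrite !ffunE.
  by rewrite eq_sym (negPf (neq_lift _ _)).
apply: IH => [|l /zz' zl]; last by rewrite ffunE; case: eqP => [->|].
rewrite -ltnS; apply: leq_trans zm; apply: proper_card; apply/properP; split.
  by apply/fintype.subsetP => l; rewrite !inE ffunE; case: (l =P i) => [->|//]; rewrite eqxx.
by exists i; rewrite !inE ?ffunE ?eqxx.
Qed.

Lemma interferes_refl (y : outcomes R n) (i : 'I_n) : interferes y i i.
Proof. by rewrite /interferes eqxx. Qed.

Lemma dependentxx (y : outcomes R n) (i : 'I_n) : dependent y i i.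
Proof. by apply/existsP; exists i; rewrite interferes_refl. Qed.

(** Each unit is dependent on itself, so each of the [n] inner sums is at least 1. *)
Lemma d_avg_ge1 (y : outcomes R n) : (0 < n)%N -> 1 <= d_avg y.
Proof.
move=> n0; rewrite /d_avg ler_pdivlMl ?ltr0n// mulr1.
rewrite -[X in X%:R <= _](card_ord n) -sum1_card natr_sum; apply: ler_sum => i _.
by rewrite (bigD1 i)//= dependentxx lerDl sumr_ge0.
Qed.

(** Lets auxiliary outcomes, such as constant or centered ones, be controlled at the rate of [y]. *)
Lemma ler_d_avg (u y : outcomes R n) :
  (forall i j, interferes u i j -> interferes y i j) -> d_avg u <= d_avg y.
Proof.
move=> uy; rewrite /d_avg ler_wpM2l ?invr_ge0 ?ler0n//.
apply: ler_sum => i _; apply: ler_sum => j _; rewrite ler_nat.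
case duij : (dependent u i j) => //; have/existsP[l /andP[li lj]] := duij.
by rewrite lt0b; apply/existsP; exists l; rewrite !uy.
Qed.

(** Expand the square over pairs. An independent pair contributes the product of two zero means; a
    dependent pair contributes at most [C], since 2ab <= a^2 + b^2. The number of dependent pairs is
    [n%:R * d_avg y]. *)
Lemma Ex_sqr_sum_le D (y : outcomes R n) (g : 'I_n -> assignment n -> R) (C : R) :
  bernoulli_design D ->
  (forall j, depends_on (fun i => interferes y i j) (g j)) ->
  (forall j, Ex D (g j) = 0) ->
  (forall j, Ex D (fun z => g j z ^+ 2) <= C) ->
  Ex D (fun z => (\sum_j g j z) ^+ 2) <= C * (n%:R * d_avg y).
Proof.
move=> Db gdep g0 gC.
have [n0|n0] := posnP n.
  rewrite (_ : n%:R = 0) ?n0// mul0r mulr0 (@eq_Ex _ _ _ _ (fun=> 0)) ?Ex_cst// => z.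
  by rewrite big1 ?expr0n// => i; have := ltn_ord i; rewrite {2}n0.
rewrite /d_avg mulVKf ?pnatr_eq0 -?lt0n//.
rewrite (@eq_Ex _ _ _ _ (fun z => \sum_i \sum_j g i z * g j z)); last first.
  by move=> z; rewrite expr2 mulr_suml; apply: eq_bigr => i _; rewrite mulr_sumr.
rewrite Ex_sum mulr_sumr; apply: ler_sum => i _.
rewrite Ex_sum mulr_sumr; apply: ler_sum => j _.
case dij : (dependent y i j).
  rewrite mulr1.
  apply: (@le_trans _ _ (Ex D (fun z => 2^-1 * (g i z ^+ 2 + g j z ^+ 2)))).
    by apply: ler_Ex => z; have := sqr_ge0 (g i z - g j z); nra.
  rewrite ExZ ExD; have := gC i; have := gC j; lra.
rewrite mulr0 (Ex_indep Db _ (gdep i) (gdep j)) ?g0 ?mul0r//.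
(* A coordinate interfering with both [i] and [j] would witness [dependent y i j], so the two
   coordinate sets are disjoint. *)
move=> l /= li; apply: contraFN dij => lj; apply/existsP; exists l.
by rewrite li.
Qed.

End Independence.

(** * Unbiasedness and mean square error of the weighted mean in one arm *)

Section InverseProbabilityWeighting.
Context {R : realType} {n : nat}.
Implicit Types (D : design R n) (u y : outcomes R n) (b : bool) (i : 'I_n)
  (z : assignment n).

Definition prob_arm D b i : R :=
  if b then prob_treated D i else 1 - prob_treated D i.

Definition ipw D b i z : R := (z i == b)%:R / prob_arm D b i.

Definition arm_outcome b u i z : R := u i (insert i b (delete i z)).

Definition arm_mean D b u : R := n%:R^-1 * \sum_i Ex D (arm_outcome b u i).

Definition ht_mean D b u z : R := n%:R^-1 * \sum_i ipw D b i z * u i z.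

Lemma insert_deleteK i z : insert i (z i) (delete i z) = z.
Proof.
apply/ffunP => j; rewrite ffunE; case: unliftP => [j' ->|->] //.
by rewrite ffunE.
Qed.

Lemma depends_on_ipw D b i : depends_on (fun j => j == i) (ipw D b i).
Proof. by move=> z z' zz'; rewrite /ipw zz' ?eqxx. Qed.

Lemma depends_on_arm_outcome b u i :
  depends_on (fun j => j != i) (arm_outcome b u i).
Proof.
move=> z z' zz'; congr (u i _); apply/ffunP => j; rewrite !ffunE.
by case: unliftP => // j' _; rewrite !ffunE zz'// eq_sym neq_lift.
Qed.

Lemma Ex_ipw D b i : prob_arm D b i != 0 -> Ex D (ipw D b i) = 1.
Proof.
move=> p0; rewrite (@eq_Ex _ _ _ _ (fun z => (prob_arm D b i)^-1 * (z i == b)%:R)); last first.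
  by move=> z; rewrite mulrC.
rewrite ExZ; suff -> : Ex D (fun z => (z i == b)%:R) = prob_arm D b i by rewrite mulVf.
rewrite /prob_arm /prob_treated PrE; case: b p0 => _.
  by apply: eq_Ex => z; case: (z i).
rewrite -[X in X - _](Ex_cst D) -ExB; apply: eq_Ex => z.
by case: (z i); rewrite /= ?subrr ?subr0.
Qed.

(** Where the weight is nonzero, z_i = [b] and the observed outcome is [arm_outcome b u i]. That
    outcome depends only on the other coordinates, so it is independent of the weight, which has
    mean 1. *)
Lemma Ex_ipwM D b u i : bernoulli_design D -> prob_arm D b i != 0 ->
  Ex D (fun z => ipw D b i z * u i z) = Ex D (arm_outcome b u i).
Proof.
move=> Db p0; rewrite -[RHS]mul1r -(Ex_ipw p0).
rewrite -(Ex_indep Db _ (@depends_on_ipw D b i) (@depends_on_arm_outcome b u i)).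
  apply: eq_Ex => z; rewrite /ipw /arm_outcome.
  by case: eqP => [<-|_]; rewrite ?insert_deleteK// !mul0r.
by move=> j; rewrite negbK.
Qed.

Section Overlap.
Variables (D : design R n) (k : R).
Hypotheses (k_gt0 : 0 < k)
  (overlap : forall i, k^-1 <= prob_treated D i <= 1 - k^-1).

Lemma prob_arm_ge b i : k^-1 <= prob_arm D b i.
Proof. by have /andP[] := overlap i; rewrite /prob_arm; case: b; lra. Qed.

Lemma prob_arm_gt0 b i : 0 < prob_arm D b i.
Proof. by apply: lt_le_trans (prob_arm_ge b i); rewrite invr_gt0. Qed.

Lemma ipw_ge0 b i z : 0 <= ipw D b i z.
Proof. by rewrite divr_ge0 ?ler0n// ltW// prob_arm_gt0. Qed.

Lemma ipw_le b i z : ipw D b i z <= k.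
Proof.
rewrite /ipw ler_pdivrMr ?prob_arm_gt0// (@le_trans _ _ 1)//.
  by case: (_ == _).
by rewrite -(divff (lt0r_neq0 k_gt0)) ler_pM2l ?prob_arm_ge.
Qed.

(** Overlap confines the weights to the interval from 0 to [k]. *)
Lemma Ex_sqr_ipwM_le b u i (C : R) : Ex D (fun z => u i z ^+ 2) <= C ->
  Ex D (fun z => (ipw D b i z * u i z) ^+ 2) <= k ^+ 2 * C.
Proof.
move=> uC; apply: (@le_trans _ _ (Ex D (fun z => k ^+ 2 * u i z ^+ 2))).
  apply: ler_Ex => z; rewrite exprMn ler_wpM2r ?sqr_ge0//.
  by rewrite lerXn2r ?nnegrE ?ipw_ge0 ?ipw_le// ltW.
by rewrite ExZ ler_wpM2l ?sqr_ge0.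
Qed.

(** By unbiasedness the error is the average of the centered summands [g i], to which the bound on
    sums with few dependent pairs applies. *)
Lemma ht_mean_mse_le b u (C : R) : bernoulli_design D ->
  (forall i, Ex D (fun z => u i z ^+ 2) <= C) ->
  Ex D (fun z => (ht_mean D b u z - arm_mean D b u) ^+ 2) <=
    k ^+ 2 * C * (d_avg u / n%:R).
Proof.
move=> Db uC; have [n0|n0] := posnP n.
  (* With no units both sides vanish, because the inverse of 0 is 0. *)
  have nR0 : n%:R^-1 = 0 :> R by rewrite n0 invr0.
  rewrite nR0 !mulr0 (@eq_Ex _ _ _ _ (fun=> 0)) ?Ex_cst// => z.
  by rewrite /ht_mean /arm_mean nR0 !mul0r subrr expr0n.
pose g i z := ipw D b i z * u i z - Ex D (fun z => ipw D b i z * u i z).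
rewrite (@eq_Ex _ _ _ _ (fun z => n%:R^-1 ^+ 2 * (\sum_i g i z) ^+ 2)); last first.
  move=> z; rewrite -exprMn /ht_mean /arm_mean -mulrBr -sumrB.
  congr ((_ * _) ^+ 2); apply: eq_bigr => i _; rewrite /g Ex_ipwM//.
  by rewrite gt_eqF ?prob_arm_gt0.
rewrite ExZ.
have -> : k ^+ 2 * C * (d_avg u / n%:R) =
    n%:R^-1 ^+ 2 * (k ^+ 2 * C * (n%:R * d_avg u)).
  by field; rewrite pnatr_eq0 -lt0n.
rewrite ler_wpM2l ?sqr_ge0//; apply: Ex_sqr_sum_le => // j.
(* The weight of unit [j] depends on coordinate [j] alone, and [j] interferes with itself. *)
- move=> z z' zz'; rewrite /g (depends_on_interferes zz').
  by congr (_ * _ - _); apply: depends_on_ipw => i /eqP ->; rewrite zz' ?interferes_refl.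
- by rewrite /g ExB Ex_cst subrr.
- by apply: le_trans (Ex_sqr_centered _ _) _; exact: Ex_sqr_ipwM_le.
Qed.

End Overlap.
End InverseProbabilityWeighting.

(** * Calculus of stochastic orders *)

Section StochasticOrder.
Context {R : realType}.
Variable D : forall n, design R n.
Implicit Types (X Y : forall n, assignment n -> R) (a : nat -> R).

(** Any fixed threshold [e] eventually exceeds [M * a n]. *)
Lemma bigO_in_prob_cvg0 X a : a n @[n --> \oo] --> (0 : R) ->
  bigO_in_prob D X a -> cvg_in_prob0 D X.
Proof.
move=> a0 XO e e0; apply/cvgrPdist_le => d /XO[M XM].
have Ma0 : M * a n @[n --> \oo] --> (0 : R).
  by rewrite -(mulr0 M); apply: cvgMr.
near=> n; rewrite sub0r normrN ger0_norm ?Pr_ge0//.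
apply: le_trans (_ : Pr (D n) (fun z => M * a n < `|X n z|) <= d).
  apply: ler_Pr => z; apply: lt_trans; near: n.
  exact: (cvgr_lt _ Ma0).
by near: n.
Unshelve. all: by end_near. Qed.

Lemma bigO_in_probB X Y a : (forall n, 0 <= a n) ->
  bigO_in_prob D X a -> bigO_in_prob D Y a ->
  bigO_in_prob D (fun n z => X n z - Y n z) a.
Proof.
move=> a0 XO YO e e0; have e20 : 0 < e / 2 by rewrite divr_gt0.
have [M XM] := XO _ e20; have [N YN] := YO _ e20.
exists (M + N); near=> n.
apply: (@le_trans _ _ (Pr (D n) (fun z => M * a n < `|X n z|) +
                       Pr (D n) (fun z => N * a n < `|Y n z|))).
  apply: Pr_union_le => z; apply: contraTT; rewrite negb_or -!leNgt => /andP[XMz YNz].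
  by rewrite (le_trans (ler_normB _ _))// mulrDl lerD.
by rewrite [e]splitr lerD//; near: n.
Unshelve. all: by end_near. Qed.

Lemma bigO_in_prob_mse X a (K : R) : (\forall n \near \oo, 0 < a n) ->
  (forall n, Ex (D n) (fun z => X n z ^+ 2) <= K * a n ^+ 2) ->
  bigO_in_prob D X a.
Proof.
(* Taking the maximum with 1 keeps the threshold positive. With [M] the square root of [K1 / e],
   Chebyshev's bound at [M * a n] is at most [e]. *)
move=> a0 XK e e0; set K1 := Num.max 1 K.
have K10 : 0 < K1 by rewrite lt_max ltr01.
exists (Num.sqrt (K1 / e)); near=> n.
have an0 : 0 < a n by near: n.
have M0 : 0 < Num.sqrt (K1 / e) by rewrite sqrtr_gt0 divr_gt0.
apply: le_trans (chebyshev_Pr _ _ (mulr_gt0 M0 an0)) _.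
rewrite exprMn sqr_sqrtr; last by rewrite divr_ge0 ?ltW.
rewrite ler_pdivrMr; last by rewrite mulr_gt0 ?divr_gt0 ?exprn_gt0.
apply: le_trans (XK n) _; rewrite [leRHS]mulrA (mulrC e) divfK ?gt_eqF//.
by rewrite ler_wpM2r ?sqr_ge0// le_max lexx orbT.
Unshelve. all: by end_near. Qed.

(** The domination of [X] by [Y] is assumed only where [T] is small. The complement has vanishing
    probability, eventually at most half of [e]; the other half is spent on [Y]. *)
Lemma bigO_in_prob_of_event X Y (T : forall n, assignment n -> R) a (c e0 : R) :
  (forall n, 0 <= a n) -> 0 < c -> 0 < e0 -> cvg_in_prob0 D T ->
  (forall n z, `|T n z| <= e0 -> `|X n z| <= c * `|Y n z|) ->
  bigO_in_prob D Y a -> bigO_in_prob D X a.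
Proof.
move=> a0 c0 e00 T0 XY YO e ep; have e20 : 0 < e / 2 by rewrite divr_gt0.
have [M YM] := YO _ e20; exists (c * M); near=> n.
apply: (@le_trans _ _ (Pr (D n) (fun z => e0 < `|T n z|) +
                       Pr (D n) (fun z => M * a n < `|Y n z|))).
  apply: Pr_union_le => z; apply: contraTT; rewrite negb_or -!leNgt => /andP[Te YMz].
  by rewrite (le_trans (XY _ _ Te))// -mulrA ler_wpM2l// ltW.
rewrite [e]splitr lerD//; last by near: n.
near: n; exact: (cvgr_le _ (T0 _ e00)).
Unshelve. all: by end_near. Qed.

End StochasticOrder.

(** Pointwise |x|^m <= 1 + |x|^q, by cases on |x| <= 1. This turns the moments of real order in
    Assumption R into second and first moments. *)
Lemma powR_moment_le (R : realType) (n : nat) (D : design R n)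
    (X : assignment n -> R) (m : nat) (q C : R) : m%:R <= q ->
  Ex D (fun z => `|X z| `^ q) <= C -> Ex D (fun z => `|X z| ^+ m) <= 1 + C.
Proof.
move=> mq XC; apply: le_trans (_ : 1 + Ex D (fun z => `|X z| `^ q) <= _); last first.
  by rewrite lerD2l.
rewrite -[X in X + _](Ex_cst D) -ExD; apply: ler_Ex => z.
have [X1|X1] := leP `|X z| 1.
  by rewrite -[leLHS]addr0 lerD ?powR_ge0// exprn_ile1.
by rewrite -[leLHS]add0r lerD// -powR_mulrn// ler_powR// ltW.
Qed.

(** * Both estimators and the estimand as differences between arms *)

Section Estimators.
Context {R : realType} {n : nat}.
Implicit Types (D : design R n) (y : outcomes R n) (b : bool)
  (z : assignment n).

(** The weighted mean of these outcomes is the Hájek denominator divided by [n]. *)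
Definition ones : outcomes R n := fun _ _ => 1.

Definition ha_mean D b y z : R :=
  (\sum_i ipw D b i z * y i z) / \sum_i ipw D b i z.

Lemma ipwE D b i z : ipw D b i z =
  if b then (z i)%:R / prob_treated D i
  else (1 - (z i)%:R) / (1 - prob_treated D i).
Proof. by rewrite /ipw; case: b; case: (z i); rewrite /= ?subr0 ?subrr. Qed.

Lemma tau_HTE D y z : tau_HT D y z = ht_mean D true y z - ht_mean D false y z.
Proof.
by congr (_ * _ - _ * _); apply: eq_bigr => i _; rewrite ipwE mulrAC.
Qed.

Lemma tau_HAE D y z : tau_HA D y z = ha_mean D true y z - ha_mean D false y z.
Proof.
by congr (_ / _ - _ / _); apply: eq_bigr => i _; rewrite ipwE // mulrAC.
Qed.

Lemma tau_EATEE D y : tau_EATE D y = arm_mean D true y - arm_mean D false y.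
Proof.
rewrite /arm_mean -mulrBr -sumrB; congr (_ * _).
by apply: eq_bigr => i _; rewrite ExB.
Qed.

Lemma ht_mean_ones D b z : ht_mean D b ones z = n%:R^-1 * \sum_i ipw D b i z.
Proof. by congr (_ * _); apply: eq_bigr => i _; rewrite mulr1. Qed.

Lemma arm_mean_ones D b : (0 < n)%N -> arm_mean D b ones = 1.
Proof.
move=> n0; rewrite /arm_mean; under eq_bigr do rewrite Ex_cst.
by rewrite sumr_const card_ord mulVf// pnatr_eq0 -lt0n.
Qed.

Lemma ht_mean_shift D b y (c : R) z :
  ht_mean D b (fun i z => y i z - c) z = ht_mean D b y z - c * ht_mean D b ones z.
Proof.
rewrite /ht_mean [c * _]mulrCA -mulrBr [c * _]mulr_sumr -sumrB; congr (_ * _).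
by apply: eq_bigr => i _; rewrite /ones; ring.
Qed.

(** Hence the weighted mean of the centered outcomes, the Hájek numerator, is its own estimation
    error. *)
Lemma arm_mean_centered D b y :
  arm_mean D b (fun i z => y i z - arm_mean D b y) = 0.
Proof.
rewrite {1}/arm_mean.
under eq_bigr do rewrite ExB Ex_cst.
rewrite sumrB mulrBr -/(arm_mean D b y) sumr_const card_ord.
have [n0|n0] := posnP n.
  by rewrite /arm_mean (_ : n%:R^-1 = 0 :> R) ?n0 ?invr0// !mul0r subrr.
by rewrite -[arm_mean _ _ _ *+ n]mulr_natl mulKf ?subrr// pnatr_eq0 -lt0n.
Qed.

Lemma norm_arm_mean_le D b y (M : R) : 0 <= M ->
  (forall i, `|Ex D (arm_outcome b y i)| <= M) -> `|arm_mean D b y| <= M.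
Proof.
move=> M0 yM; have [n0|n0] := posnP n.
  by rewrite /arm_mean (_ : n%:R^-1 = 0 :> R) ?n0 ?invr0// mul0r normr0.
rewrite normrM ger0_norm ?invr_ge0// ler_pdivrMl ?ltr0n//.
apply: le_trans (ler_norm_sum _ _ _) _.
apply: le_trans (ler_sum _ (fun i _ => yM i)) _.
by rewrite sumr_const card_ord mulr_natl.
Qed.

(* With A and B the weighted means of y and of 1, A/B - m = (A - mB)/B, and
   A - mB is the weighted mean of y - m. *)
Lemma ha_mean_error_le D b y z (m := arm_mean D b y) :
  `|ht_mean D b ones z - arm_mean D b ones| <= 2^-1 ->
  `|ha_mean D b y z - m| <= 2 * `|ht_mean D b (fun i z => y i z - m) z|.
Proof.
have [n0|n0] := posnP n.
  move=> _; rewrite /ha_mean big1 => [|i _]; last first.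
    by have := ltn_ord i; rewrite {2}n0.
  rewrite mul0r {1}/m /arm_mean (_ : n%:R^-1 = 0 :> R) ?n0 ?invr0// mul0r subrr.
  by rewrite normr0 mulr_ge0.
have nR0 : n%:R != 0 :> R by rewrite pnatr_eq0 -lt0n.
rewrite arm_mean_ones// ht_mean_shift ler_distl => /andP[B2 _].
(* The normalized denominator is within 1/2 of 1, hence at least 1/2; this gives the factor 2. *)
have {}B2 : 2^-1 <= ht_mean D b ones z by move: B2; lra.
have B0 : 0 < ht_mean D b ones z by apply: lt_le_trans B2.
have -> : ha_mean D b y z - m =
    (ht_mean D b y z - m * ht_mean D b ones z) / ht_mean D b ones z.
  rewrite mulrBl mulfK ?gt_eqF//; congr (_ - _).
  by rewrite ht_mean_ones /ht_mean /ha_mean -mulf_div divff ?mul1r// invr_eq0.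
rewrite normrM mulrC normfV (gtr0_norm B0) ler_wpM2r//.
by rewrite -[leRHS]invrK lef_pV2 ?posrE ?invr_gt0.
Qed.

End Estimators.

(** * The rate and its convergence to zero *)

Section Rate.
Context {R : realType}.

Definition rate (y : forall n : nat, outcomes R n) (n : nat) : R := n%:R `^ (- 2^-1) * d_avg (y n) `^ 2^-1.

Lemma rate_ge0 (y : forall n : nat, outcomes R n) n : 0 <= rate y n.
Proof. by rewrite mulr_ge0 ?powR_ge0. Qed.

(** This also covers [n] = 0, where both sides are 0 by the convention for inverses. *)
Lemma sqr_rate (y : forall n : nat, outcomes R n) n :
  rate y n ^+ 2 = d_avg (y n) / n%:R.
Proof.
have d0 : 0 <= d_avg (y n).
  by rewrite mulr_ge0 ?invr_ge0// sumr_ge0// => i _; rewrite sumr_ge0.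
by rewrite /rate powRN !powR12_sqrt// exprMn exprVn !sqr_sqrtr// mulrC.
Qed.

Lemma rate_gt0 (y : forall n : nat, outcomes R n) n :
  (0 < n)%N -> 0 < rate y n.
Proof.
move=> n0; rewrite mulr_gt0 ?powR_gt0 ?ltr0n//.
exact: lt_le_trans ltr01 (d_avg_ge1 _ n0).
Qed.

Lemma rate_cvg0 (y : forall n : nat, outcomes R n) :
  (fun n => d_avg (y n)) =o_\oo (fun n => n%:R : R) ->
  rate y n @[n --> \oo] --> (0 : R).
Proof.
move=> /eqoP dn; apply/cvgrPdist_le => e e0.
(* The little-o bound is taken at [e ^+ 2], since squares are compared below. *)
have {}dn := dn _ (exprn_gt0 2 e0).
near=> n; rewrite sub0r normrN ger0_norm ?rate_ge0//.
rewrite -(@ler_pXn2r _ 2) ?nnegrE ?rate_ge0 ?(ltW e0)// sqr_rate.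
rewrite ler_pdivrMr ?ltr0n; last by near: n; exact: nbhs_infty_gt.
rewrite -[X in _ * X]ger0_norm//; apply: le_trans (ler_norm _) _.
by near: n.
Unshelve. all: by end_near. Qed.

End Rate.

(** * Rates for the weighted mean and the Hájek ratio in one arm *)

Section Consistency.
Context {R : realType}.
Variable D : forall n : nat, design R n.
Hypothesis D_bernoulli : forall n, bernoulli_design (D n).
Variable k : R.
Hypotheses (k_gt0 : 0 < k) (overlap : forall n (i : 'I_n),
  k^-1 <= prob_treated (D n) i <= 1 - k^-1).

(** The averaged outcomes [u] are kept apart from the [y] that fixes the rate, so that the lemma
    serves for the original, constant and centered outcomes alike. *)
Lemma ht_mean_bigO b (y u : forall n : nat, outcomes R n) (C : R) :
  (forall n i j, interferes (u n) i j -> interferes (y n) i j) ->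
  (forall n i, Ex (D n) (fun z => u n i z ^+ 2) <= C) ->
  bigO_in_prob D
    (fun n z => ht_mean (D n) b (u n) z - arm_mean (D n) b (u n)) (rate y).
Proof.
(* The sample of size 1 has a unit, whose second moment bounds [C] from below. *)
move=> uy uC; have C0 : 0 <= C.
  apply: le_trans (uC 1%N ord0).
  by rewrite -(Ex_cst (D 1) 0); apply: ler_Ex => z; rewrite sqr_ge0.
apply: (@bigO_in_prob_mse _ _ _ _ (k ^+ 2 * C)).
  by near=> n; apply: rate_gt0; near: n; exact: nbhs_infty_gt.
move=> n; apply: le_trans (ht_mean_mse_le k_gt0 (@overlap n) b (@D_bernoulli n) (uC n)) _.
rewrite sqr_rate ler_wpM2l ?mulr_ge0 ?(ltW k_gt0)//.
by rewrite ler_wpM2r ?invr_ge0// ler_d_avg//; exact: uy.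
Unshelve. all: by end_near. Qed.

Lemma ha_mean_bigO b (y : forall n : nat, outcomes R n) (C M : R) :
  rate y n @[n --> \oo] --> (0 : R) ->
  (forall n i, Ex (D n) (fun z => y n i z ^+ 2) <= C) ->
  (forall n, `|arm_mean (D n) b (y n)| <= M) ->
  bigO_in_prob D
    (fun n z => ha_mean (D n) b (y n) z - arm_mean (D n) b (y n)) (rate y).
Proof.
move=> rate0 yC mM; pose u n i z := y n i z - arm_mean (D n) b (y n).
have onesO : bigO_in_prob D
    (fun n z => ht_mean (D n) b ones z - arm_mean (D n) b ones) (rate y).
  apply: (@ht_mean_bigO _ _ _ 1) => n i => [j|]; last first.
    by rewrite -[leRHS](Ex_cst (D n)); apply: ler_Ex => z; rewrite expr1n.
  (* Under constant outcomes a unit interferes only with itself. *)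
  case/orP => [/eqP->|/existsP[z /existsP[z' /andP[_]]]]; last by rewrite eqxx.
  exact: interferes_refl.
have uO : bigO_in_prob D
    (fun n z => ht_mean (D n) b (u n) z - arm_mean (D n) b (u n)) (rate y).
  (* The constant comes from (y - m)^2 <= 2 y^2 + 2 m^2 with |m| <= [M]. Subtracting a constant
     creates no interference. *)
  apply: (@ht_mean_bigO _ _ _ (2 * C + 2 * M ^+ 2)) => n i => [j|].
    case/orP => [/eqP->|/existsP[z /existsP[z' /andP[zz' uzz']]]].
      exact: interferes_refl.
    apply/orP; right; apply/existsP; exists z; apply/existsP; exists z'.
    by rewrite zz' /=; apply: contraNneq uzz' => yzz'; rewrite /u yzz'.
  apply: le_trans (_ : Ex (D n) (fun z => 2 * y n i z ^+ 2 + 2 * M ^+ 2) <= _).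
    apply: ler_Ex => z; rewrite /u; have := mM n; set m := arm_mean _ _ _.
    rewrite ler_norml => /andP[mM1 mM2].
    have mM3 : m ^+ 2 <= M ^+ 2 by nra.
    by have := sqr_ge0 (y n i z + m); nra.
  by rewrite ExD ExZ Ex_cst lerD2r ler_wpM2l.
(* The event is that the normalized denominator is within 1/2 of 1; its complement has vanishing
   probability because the rate tends to 0. *)
apply: (bigO_in_prob_of_event (c := 2) (e0 := 2^-1) (rate_ge0 y) _ _
  (bigO_in_prob_cvg0 rate0 onesO) _ uO); rewrite ?invr_gt0 ?ltr0n// => n z.
by rewrite arm_mean_centered subr0; exact: ha_mean_error_le.
Qed.

End Consistency.

(** * Combining the two arms under Assumption R *)

Theorem proposition2 (R : realType)
    (y : forall n : nat, outcomes R n) (D : forall n : nat, design R n)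
    (D_bernoulli : forall n : nat, bernoulli_design (D n))
    (yD_regular : regularity D y)
    (restricted_interference :
       (fun n : nat => d_avg (y n)) =o_\oo (fun n : nat => n%:R : R)) :
  let HT_error n z := tau_HT (D n) (y n) z - tau_EATE (D n) (y n) in
  let HA_error n z := tau_HA (D n) (y n) z - tau_EATE (D n) (y n) in
  let rate n := n%:R `^ (- 2^-1) * d_avg (y n) `^ 2^-1 in
  [/\ cvg_in_prob0 D HT_error,
      cvg_in_prob0 D HA_error,
      bigO_in_prob D HT_error rate &
      bigO_in_prob D HA_error rate].
Proof.
move=> HT_error HA_error r.
have r0 : r n @[n --> \oo] --> (0 : R) by exact: rate_cvg0.
have [k [q [s [k0 q2 s1 reg]]]] := yD_regular.
have overlap n (i : 'I_n) : k^-1 <= prob_treated (D n) i <= 1 - k^-1.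
  by have [] := reg n i.
have yC n i : Ex (D n) (fun z => y n i z ^+ 2) <= 1 + k `^ q.
  have [_ yq _] := reg n i; apply: le_trans (powR_moment_le q2 yq).
  by apply: ler_Ex => z; rewrite real_normK ?num_real.
(* The moments of order [s] of the potential outcomes bound the arm means, as the centering in the
   Hájek argument requires. *)
have mM b n : `|arm_mean (D n) b (y n)| <= 1 + k `^ s.
  apply: norm_arm_mean_le => [|i]; first by rewrite addr_ge0 ?powR_ge0.
  have [_ _ /(_ b) ys] := reg n i; apply: le_trans (ler_norm_Ex _ _) _.
  exact: (powR_moment_le (m := 1) s1 ys).
(* Since the estimand is a difference of arm means, one argument on arm errors serves both
   estimators. *)
have errorB (f : bool -> forall n, assignment n -> R) :
    (forall b, bigO_in_prob D (fun n z => f b n z - arm_mean (D n) b (y n)) r) ->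
    bigO_in_prob D
      (fun n z => f true n z - f false n z - tau_EATE (D n) (y n)) r.
  move=> fO.
  rewrite (_ : (fun n z => _) = fun n z => (f true n z - arm_mean (D n) true (y n)) -
      (f false n z - arm_mean (D n) false (y n))).
    exact: bigO_in_probB (rate_ge0 y) (fO true) (fO false).
  apply/functional_extensionality_dep => n; apply/funext => z.
  by rewrite tau_EATEE; ring.
have HTO : bigO_in_prob D HT_error r.
  rewrite (_ : HT_error = fun n z => ht_mean (D n) true (y n) z -
      ht_mean (D n) false (y n) z - tau_EATE (D n) (y n)).
    apply: (errorB (fun b n => ht_mean (D n) b (y n))) => b.
    exact: (ht_mean_bigO D_bernoulli k0 overlap).
  apply/functional_extensionality_dep => n; apply/funext => z.
  by rewrite /HT_error tau_HTE.
have HAO : bigO_in_prob D HA_error r.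
  rewrite (_ : HA_error = fun n z => ha_mean (D n) true (y n) z -
      ha_mean (D n) false (y n) z - tau_EATE (D n) (y n)).
    apply: (errorB (fun b n => ha_mean (D n) b (y n))) => b.
    exact: (ha_mean_bigO D_bernoulli k0 overlap r0).
  apply/functional_extensionality_dep => n; apply/funext => z.
  by rewrite /HA_error tau_HAE.
by split => //; apply: bigO_in_prob_cvg0 r0 _.
Qed.
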